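(* Let $\widetilde{\rho} = (k-1,1,1)$. For every integer $k \geq 1$, $$\vert \mathbb{S}(2^3,\widetilde{\rho}) \vert = \frac{1}{2}k^2 + \frac{3}{2}k,$$ $$\vert \mathbb{S}(3^3,\widetilde{\rho}) \vert = \frac{2}{3}k^4 + 3 k^3 + \frac{7}{3}k^2 - k,$$ $$\vert \mathbb{S}(4^3,\widetilde{\rho}) \vert = \frac{25}{18}k^6 + \frac{61}{8}k^5 + \frac{175}{18}k^4 - \frac{35}{24}k^3 - \frac{37}{9}k^2 + \frac{5}{6}k.$$
   Context: $n^3$ denotes the three-row rectangular shape $(n,n,n)$. The Young diagram of shape $\lambda=(\lambda_1,\dots,\lambda_m)$ is the left-justified array with $\lambda_i$ cells in the $i$-th row from the top; $(i,j)$ is the cell in row $i$, column $j$. $\mathbb{S}(\lambda,\rho)$ is the set of standard set-valued Young tableaux of shape $\lambda$ and row-constant density $\rho=(\rho_1,\dots,\rho_m)$: assignments of the integers $1,\dots,M$, $M=\sum_i\lambda_i\rho_i$, to the cells so that each cell in row $i$ receives precisely $\rho_i$ integers (unordered within the cell), and for each cell $(i,j)$ every integer in it is smaller than every integer in the cells $(i+1,j)$ and $(i,j+1)$. In the degenerate case $k=1$ the top-row cells are empty, and the tableaux are just standard Young tableaux formed by the second and third rows. The numbers $\widetilde{C}^k_{3,n}:=\vert\mathbb{S}(n^3,\widetilde\rho)\vert$ are called the non-involutory three-dimensional $k$-Catalan numbers. *)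

(* Defs.v *)
From HB Require Import structures.
From mathcomp Require Import all_boot.

Set Implicit Arguments.
Unset Strict Implicit.
Unset Printing Implicit Defensive.

(* Rows and columns are numbered from 0, and the integers 1, ..., M are encoded
   by 'I_M (the integer m.+1 is represented by m : 'I_M). *)

Definition cell (la : seq nat) : finType :=
  {i : 'I_(size la) & 'I_(nth 0 la i)}.

Definition cell_row (la : seq nat) (c : cell la) : nat := tag c.
Definition cell_col (la : seq nat) (c : cell la) : nat := tagged c.

Definition right_of (la : seq nat) (c d : cell la) : bool :=
  (cell_row d == cell_row c) && (cell_col d == (cell_col c).+1).

Definition below (la : seq nat) (c d : cell la) : bool :=
  (cell_row d == (cell_row c).+1) && (cell_col d == cell_col c).

Definition ssvt_size (la rho : seq nat) : nat :=
  \sum_(i < size la) nth 0 la i * nth 0 rho i.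

(* A filling maps each integer to the cell that receives it; the content of a
   cell is its fibre, hence an unordered set of integers. *)
Definition filling (la rho : seq nat) : finType :=
  {ffun 'I_(ssvt_size la rho) -> cell la}.

Definition content (la rho : seq nat) (T : filling la rho) (c : cell la) :
    {set 'I_(ssvt_size la rho)} :=
  [set m | T m == c].

Definition has_density (la rho : seq nat) (T : filling la rho) : bool :=
  [forall c : cell la, #|content T c| == nth 0 rho (cell_row c)].

Definition is_standard (la rho : seq nat) (T : filling la rho) : bool :=
  [forall c : cell la, forall d : cell la,
     (right_of c d || below c d) ==>
     [forall m in content T c, forall p in content T d, m < p]].

Definition SSVT (la rho : seq nat) : {set filling la rho} :=
  [set T : filling la rho | has_density T && is_standard T].

(* Main.v *)
Require Import Defs.
From HB Require Import structures.
From mathcomp Require Import all_boot all_order all_algebra.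
From mathcomp Require Import zify ring.

Set Implicit Arguments.
Unset Strict Implicit.
Unset Printing Implicit Defensive.

(* Reading off the rows that receive 1, ..., M turns a standard set-valued
   tableau of shape n^3 and density (K, 1, 1), K = k - 1, into a word with nK
   zeros, n ones and n twos each of whose prefixes satisfies #0 >= K * #1 and
   #1 >= #2. This is a bijection: each row is increasing, so the column of an
   integer is its rank within its row divided by the density of the row.
   Let E(b, c, t) count the admissible words with Kb + t zeros, b ones and
   c twos. Removing the last letter gives, for b > 0,
     E(b, c, t) = E(b, c, t - 1) + E(b - 1, c, K + t) + E(b, c - 1, t),
   so for fixed (b, c) the count is a polynomial in K and t; the number of
   tableaux is E(n, n, 0). *)

(** * Ballot words and the recursion on their last letter *)

Fixpoint words (r m : nat) : seq (seq nat) :=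
  if m is m'.+1 then [seq rcons w x | w <- words r m', x <- iota 0 r]
  else [:: [::]].

Lemma words_uniq r m : uniq (words r m).
Proof.
elim: m => //= m IHm; apply: allpairs_uniq; rewrite ?iota_uniq //.
by move=> [u x] [v y] _ _ /= /rcons_inj [-> ->].
Qed.

Lemma mem_words r m w : (w \in words r m) = (size w == m) && all (ltn^~ r) w.
Proof.
elim: m w => [|m IHm] w /=; first by case: w.
case/lastP: w => [|w x].
  by apply/negbTE/allpairsP => -[[u y] [_ _ /= /(congr1 size)]]; rewrite size_rcons.
rewrite size_rcons eqSS all_rcons andbCA -IHm.
apply/allpairsP/andP => [[[u y] /= [uW yr /rcons_inj [-> ->]]]|[xr wW]].
  by rewrite uW; move: yr; rewrite mem_iota.
by exists (w, x); rewrite mem_iota.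
Qed.

Definition admissible (K : nat) (w : seq nat) : bool :=
  (K * count_mem 1 w <= count_mem 0 w) && (count_mem 2 w <= count_mem 1 w).

Definition ballot (K : nat) (w : seq nat) : bool :=
  all (fun q => admissible K (take q w)) (iota 0 (size w).+1).

Lemma ballot_rcons K w x :
  ballot K (rcons w x) = admissible K (rcons w x) && ballot K w.
Proof.
rewrite /ballot size_rcons -[(size w).+2]addn1 iotaD all_cat add0n andbC.
rewrite [X in X && _]all_seq1 take_oversize ?size_rcons //; congr andb.
apply: eq_in_all => q; rewrite mem_iota ltnS => leq_q.
by rewrite -cats1 takel_cat.
Qed.

Definition ballot_word (K a b c : nat) (w : seq nat) : bool :=
  [&& count_mem 0 w == a, count_mem 1 w == b, count_mem 2 w == c & ballot K w].

Definition num_ballot (K a b c : nat) : nat :=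
  count (ballot_word K a b c) (words 3 (a + b + c)).

Lemma num_ballot_eq0 K a b c :
  ~~ ((K * b <= a) && (c <= b)) -> num_ballot K a b c = 0.
Proof.
move=> nadm; apply/eqP; rewrite -leqn0 leqNgt -has_count.
apply/negP => /hasP [w _ /and4P [/eqP ea /eqP eb /eqP ec /allP]].
move=> /(_ (size w)); rewrite mem_iota ltnSn take_size /admissible ea eb ec.
by move/(_ isT); apply/negP.
Qed.

(** Each word is split into a shorter word and its last letter. The factors [(0 < a)], [(0 < b)],
    [(0 < c)] cancel the terms in which the truncated predecessor of 0 would count spurious
    words. *)
Lemma num_ballot_rec K a b c :
  K * b <= a -> c <= b -> 0 < a + b + c ->
  num_ballot K a b c =
    (0 < a) * num_ballot K a.-1 b c + (0 < b) * num_ballot K a b.-1 c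
    + (0 < c) * num_ballot K a b c.-1.
Proof.
move=> leKb lecb; case def_m: (a + b + c) => [//|m] _.
rewrite {1}/num_ballot def_m /= count_flatten sumnE !big_map.
have step w : count (ballot_word K a b c) [seq rcons w x | x <- iota 0 3] =
    (0 < a) * ballot_word K a.-1 b c w + (0 < b) * ballot_word K a b.-1 c w
    + (0 < c) * ballot_word K a b c.-1 w.
  have adm x : ballot_word K a b c (rcons w x) =
      [&& count_mem 0 w + (x == 0) == a, count_mem 1 w + (x == 1) == b,
          count_mem 2 w + (x == 2) == c & ballot K w].
    rewrite /ballot_word ballot_rcons /admissible -!cats1 !count_cat /= !addn0.
    (* Once the three counts are fixed, admissibility of the whole word is given by [leKb] and
       [lecb], so only [ballot K w] remains. *)
    by do 3![case: eqP => //= ->]; rewrite leKb lecb.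
  rewrite /= !adm /ballot_word /= !addn0 !addn1 addnA.
  have predE n p : (n.+1 == p) = (0 < p) && (n == p.-1) by case: p.
  by rewrite !predE; do 3![case: (0 < _) => //=]; rewrite ?andbF ?mul0n ?mul1n ?addn0.
under eq_bigr => w _ do rewrite step.
rewrite !big_split -!big_distrr /=.
have sumE (P : pred (seq nat)) : \sum_(w <- words 3 m) P w = count P (words 3 m).
  by rewrite -sumn_count sumnE big_map.
rewrite !sumE /num_ballot.
congr (_ + _ + _).
- by case: a def_m {leKb step sumE} => //= a; rewrite !addSn => -[->].
- by case: b def_m {leKb lecb step sumE} => //= b; rewrite addnS addSn => -[->].
- by case: c def_m {lecb step sumE} => //= c; rewrite addnS => -[->].
Qed.

(* [t] counts the surplus of zeros over the minimum that [b] ones require. *)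
Definition excess_ballot (K b c t : nat) : nat := num_ballot K (K * b + t) b c.

Lemma excess_ballot00 K t : excess_ballot K 0 0 t = 1.
Proof.
rewrite /excess_ballot muln0 add0n; elim: t => [|t IHt].
  by rewrite /num_ballot /= /ballot_word /ballot /admissible /= muln0.
by rewrite num_ballot_rec ?muln0 //= IHt.
Qed.

Lemma excess_ballot_gt K b c t : b < c -> excess_ballot K b c t = 0.
Proof.
by move=> ltbc; rewrite /excess_ballot num_ballot_eq0 // negb_and -!ltnNge ltbc orbT.
Qed.

(** With no surplus the last letter cannot be a zero: without it, the preceding prefix would have
    fewer than [K * b.+1] zeros. *)
Lemma excess_ballot0 K b c : c <= b.+1 ->
  excess_ballot K b.+1 c 0 =
    excess_ballot K b c K + (0 < c) * excess_ballot K b.+1 c.-1 0.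
Proof.
move=> lecb; rewrite /excess_ballot num_ballot_rec ?addn0 //; last by lia.
rewrite mul1n /= [X in X + _ + _](_ : _ = 0) ?add0n ?mulnS ?[K + _]addnC //.
case: posnP => // gt0; rewrite mul1n num_ballot_eq0 // negb_and -ltnNge.
by rewrite prednK // mulnS addnC ?leqnn.
Qed.

(** Removing a final one frees the [K] zeros it required, so the surplus of the shorter word grows
    by [K]. *)
Lemma excess_ballotS K b c t : c <= b.+1 ->
  excess_ballot K b.+1 c t.+1 =
    excess_ballot K b.+1 c t + excess_ballot K b c (K + t.+1)
    + (0 < c) * excess_ballot K b.+1 c.-1 t.+1.
Proof.
move=> lecb; rewrite /excess_ballot num_ballot_rec ?leq_addr //; last by lia.
rewrite !addnS !mul1n /=; congr (_ + _ + _).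
by congr num_ballot; rewrite mulnS addnCA addnA.
Qed.

(** * Ranks of letters within a word *)

Section Counting.

Implicit Types (i q : nat) (w : seq nat).

Lemma card_ord_count n (P : pred nat) :
  #|[set m : 'I_n | P m]| = count P (iota 0 n).
Proof. by rewrite cardsE cardE /enum_mem size_filter -enumT -val_enum_ord count_map. Qed.

Lemma count_take_nth i q w : q <= size w ->
  count_mem i (take q w) = count (fun m => nth 0 w m == i) (iota 0 q).
Proof. by move=> leq; rewrite -(map_nth_iota0 0 leq) count_map. Qed.

Lemma count_takeS i q w : q < size w ->
  count_mem i (take q.+1 w) = count_mem i (take q w) + (nth 0 w q == i).
Proof. by move=> ltq; rewrite (take_nth 0) // -cats1 count_cat /= addn0. Qed.

Lemma leq_count_take i q q' w : q <= q' ->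
  count_mem i (take q w) <= count_mem i (take q' w).
Proof. by move=> le; rewrite -(subnKC le) takeD count_cat leq_addr. Qed.

(** Successive occurrences of [i] have ranks 0, 1, 2, ..., so each rank in [[s, s')] is taken once;
    the minima cut the interval at the number of occurrences seen so far. *)
Lemma count_rank i w s s' q : s <= s' -> q <= size w ->
  count (fun m => (nth 0 w m == i) && (s <= count_mem i (take m w) < s'))
    (iota 0 q) =
  minn s' (count_mem i (take q w)) - minn s (count_mem i (take q w)).
Proof.
move=> les; elim: q => [|q IHq] ltq; first by rewrite take0 /= !minn0.
rewrite -addn1 iotaD count_cat IHq 1?ltnW // add0n addn1 count_takeS //= addn0.
by case: (nth 0 w q == i) => /=; lia.
Qed.

End Counting.

(** * Tableaux of general shape and density, and their row words *)

Section Fillings.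

Variables la rho : seq nat.
Notation M := (ssvt_size la rho).
Implicit Types (T : filling la rho) (c d : cell la).

Lemma cell_inj c d : cell_row c = cell_row d -> cell_col c = cell_col d -> c = d.
Proof.
case: c d => [i j] [i' j']; rewrite /cell_row /cell_col /= => /val_inj eqi.
by case: _ / eqi j' => j' /val_inj ->.
Qed.

Lemma cell_exists i j : i < size la -> j < nth 0 la i ->
  exists c : cell la, cell_row c = i /\ cell_col c = j.
Proof.
move=> lti ltj.
by exists (Tagged (fun i : 'I_(size la) => 'I_(nth 0 la i))
             (Ordinal ltj : 'I_(nth 0 la (Ordinal lti)))).
Qed.

Lemma ltn_cell_row c : cell_row c < size la.
Proof. exact: ltn_ord. Qed.

Lemma ltn_cell_col c : cell_col c < nth 0 la (cell_row c).
Proof. exact: ltn_ord. Qed.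

Definition row_word T : seq nat := [seq cell_row (T m) | m <- enum 'I_M].

Lemma size_row_word T : size (row_word T) = M.
Proof. by rewrite size_map size_enum_ord. Qed.

Lemma nth_row_word T (m : 'I_M) : nth 0 (row_word T) m = cell_row (T m).
Proof. by rewrite (nth_map m) ?size_enum_ord // nth_ord_enum. Qed.

Lemma card_row_prefix T i q : q <= M ->
  #|[set p : 'I_M | (p < q) && (cell_row (T p) == i)]| =
  count_mem i (take q (row_word T)).
Proof.
move=> leq; rewrite count_take_nth ?size_row_word //.
transitivity #|[set p : 'I_M | (p < q) && (nth 0 (row_word T) p == i)]|.
  by apply: eq_card => p; rewrite !inE nth_row_word.
rewrite (@card_ord_count _ (fun m => (m < q) && (nth 0 (row_word T) m == i))).
rewrite -{1}(subnKC leq) iotaD count_cat add0n -[RHS]addn0; congr (_ + _).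
  by apply: eq_in_count => m; rewrite mem_iota => /andP [_ ->].
rewrite -(count_pred0 (iota q (M - q))); apply: eq_in_count => m.
by rewrite mem_iota => /andP [leqm _]; rewrite ltnNge leqm.
Qed.

Section Standard.

Variable T : filling la rho.
Hypothesis stT : T \in SSVT la rho.

Lemma card_content c : #|content T c| = nth 0 rho (cell_row c).
Proof. by move: stT; rewrite inE => /andP [/forallP /(_ c) /eqP]. Qed.

Lemma standard_lt c d (m p : 'I_M) :
  right_of c d || below c d -> T m = c -> T p = d -> m < p.
Proof.
move: stT; rewrite inE => /andP [_ /forallP /(_ c) /forallP /(_ d) /implyP st].
move=> /st /forall_inP /(_ m) /= st' Tm Tp.
have mc : m \in content T c by rewrite inE Tm.
by have /forall_inP := st' mc; apply; rewrite inE Tp.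
Qed.

Lemma content_exists c : 0 < nth 0 rho (cell_row c) -> exists m, T m = c.
Proof.
by rewrite -card_content => /card_gt0P [m]; rewrite inE => /eqP; exists m.
Qed.

(** A density may be 0, as in the top row when [K = 0], but not in a row that holds an integer. *)
Lemma density_gt0 m : 0 < nth 0 rho (cell_row (T m)).
Proof. by rewrite -card_content; apply/card_gt0P; exists m; rewrite inE. Qed.

(** Standardness compares adjacent cells only. The induction on the column distance passes through
    an integer of each intermediate cell, which exists because the density of this row is
    positive. *)
Lemma row_increasing (m p : 'I_M) :
  cell_row (T m) = cell_row (T p) -> cell_col (T m) < cell_col (T p) -> m < p.
Proof.
move=> eqr ltc; have [k defk] : exists k, cell_col (T p) = cell_col (T m) + k.+1.
  by exists (cell_col (T p) - (cell_col (T m)).+1); lia.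
elim: k p eqr {ltc} defk => [|k IHk] p eqr defk.
  by apply: (@standard_lt (T m) (T p)); rewrite // /right_of eqr defk addn1 !eqxx.
have [||e [er ec]] := @cell_exists (cell_row (T m)) (cell_col (T m) + k.+1).
- exact: ltn_cell_row.
- by have := ltn_cell_col (T p); rewrite defk eqr; lia.
have [x Tx] : exists x, T x = e.
  by apply: content_exists; rewrite er density_gt0.
apply: (@ltn_trans x); first by apply: IHk; rewrite Tx ?er ?ec.
apply: (@standard_lt e (T p)); rewrite // /right_of.
by rewrite er ec -eqr defk addnS !eqxx.
Qed.

Lemma card_left_columns i j : i < size la ->
  #|[set p | (cell_row (T p) == i) && (cell_col (T p) < j)]| =
  minn j (nth 0 la i) * nth 0 rho i.
Proof.
move=> lti; elim: j => [|j IHj].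
  by rewrite min0n mul0n; apply: eq_card0 => p; rewrite inE ltn0 andbF.
have [ltj|gej] := ltnP j (nth 0 la i); last first.
  rewrite (_ : minn j.+1 (nth 0 la i) = minn j (nth 0 la i)); last first.
    by rewrite (minn_idPr gej) (minn_idPr (leqW gej)).
  rewrite -IHj; apply: eq_card => p; rewrite !inE; case: eqP => //= eqi.
  have := ltn_cell_col (T p); rewrite eqi => /leq_trans /(_ gej) ltc.
  by rewrite ltc ltnW.
have [c [cr cc]] := cell_exists lti ltj.
rewrite (_ : [set p | _] =
  [set p | (cell_row (T p) == i) && (cell_col (T p) < j)] :|: content T c).
  rewrite cardsU IHj card_content cr [X in #|pred_of_set X|](_ : _ = set0).
    by rewrite cards0; move: ltj; nia.
  apply/setP => p; rewrite !inE; case: (T p =P c) => [->|]; last by rewrite andbF.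
  by rewrite cc ltnn andbF.
apply/setP => p; rewrite !inE ltnS leq_eqVlt.
case: (T p =P c) => [->|neq]; first by rewrite cr cc !eqxx orbT.
rewrite orbF; case: eqP => //= er; case: eqP => //= ec.
by case: neq; apply: cell_inj; rewrite ?cr ?cc.
Qed.

Lemma count_row_word i : i < size la ->
  count_mem i (row_word T) = nth 0 la i * nth 0 rho i.
Proof.
move=> lti; rewrite -[row_word T]take_size size_row_word -card_row_prefix //.
rewrite -[nth 0 la i]minnn -card_left_columns //; apply: eq_card => p.
by rewrite !inE ltn_ord /=; case: eqP => //= <-; rewrite ltn_cell_col.
Qed.

(** The integers of the row that precede [m] include all those in columns before [j], and form a
    proper subset of those in columns up to [j], since [m] itself is missing. Hence the rank of [m]
    lies between [j] and [j.+1] times the density. *)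
Lemma cell_col_rank (m : 'I_M) :
  cell_col (T m) =
  count_mem (cell_row (T m)) (take m (row_word T)) %/ nth 0 rho (cell_row (T m)).
Proof.
set i := cell_row (T m); set j := cell_col (T m).
have ltj : j < nth 0 la i := ltn_cell_col (T m).
have lti : i < size la := ltn_cell_row (T m).
have rho0 : 0 < nth 0 rho i := density_gt0 m.
rewrite -card_row_prefix 1?ltnW //; apply/eqP; rewrite eqn_leq leq_divRL //.
rewrite -(ltnS _ j) ltn_divLR //.
have := card_left_columns j.+1 lti; have := card_left_columns j lti.
rewrite (minn_idPl ltj) (minn_idPl (ltnW ltj)) => <- <-.
apply/andP; split.
  apply/subset_leq_card/subsetP => p; rewrite !inE => /andP [/eqP eqr ltc].
  by rewrite eqr eqxx andbT; apply: row_increasing.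
apply: proper_card; apply/properP; split; last first.
  by exists m; rewrite !inE ?eqxx /= ?ltnS ?leqnn ?ltnn.
apply/subsetP => p; rewrite !inE => /andP [ltpm /eqP eqr]; rewrite eqr eqxx /=.
rewrite ltnS leqNgt; apply/negP => ltc.
by have := row_increasing (esym eqr) ltc; rewrite ltnNge ltnW.
Qed.

Lemma row_word_ballot i q :
  i.+1 < size la -> nth 0 la i.+1 <= nth 0 la i -> nth 0 rho i.+1 = 1 -> q <= M ->
  nth 0 rho i * count_mem i.+1 (take q (row_word T))
    <= count_mem i (take q (row_word T)).
Proof.
move=> lti lela rho1 leq; rewrite -!card_row_prefix //.
set A := [set p : 'I_M | _ && (_ == i.+1)]; case def_b: #|A| => [|b].
  by rewrite muln0.
(* Pigeonhole: at density 1, the first [b] columns of row [i.+1] hold at most [b] integers, but [A]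
   has [b.+1]. Every integer of row [i] in columns up to [b] will turn out smaller than [p]. *)
have [p pA leb] : exists2 p, p \in A & b <= cell_col (T p).
  apply/exists_inP; apply: contraT => /exists_inPn ltb.
  suff : #|A| <= b by rewrite def_b ltnn.
  apply: leq_trans (_ : minn b (nth 0 la i.+1) * nth 0 rho i.+1 <= _); last first.
    by rewrite rho1 muln1 geq_minl.
  rewrite -card_left_columns //; apply/subset_leq_card/subsetP => p pA.
  by rewrite inE ltnNge ltb // andbT; move: pA; rewrite inE => /andP [].
move: pA; rewrite inE => /andP [ltpq /eqP rowp].
have := ltn_cell_col (T p); rewrite rowp => ltp.
have := card_left_columns b.+1 (ltnW lti).
rewrite (minn_idPl _); last by lia.
rewrite mulnC => <-; apply/subset_leq_card/subsetP => m.
rewrite !inE ltnS => /andP [/eqP rowm leqm]; rewrite rowm eqxx andbT.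
apply: leq_trans ltpq; rewrite ltnS ltnW //.
have := leq_trans leqm leb; rewrite leq_eqVlt => /orP [/eqP eqc|ltc].
  by apply: (@standard_lt (T m) (T p)); rewrite // /below rowm rowp eqc !eqxx orbT.
(* If [m] lies strictly left of the column of [p], the comparison goes down to the cell [d] below
   [m], then right to [p]. *)
have [||d [dr dc]] := @cell_exists i.+1 (cell_col (T m)); [lia|lia|].
have [y Ty] : exists y, T y = d by apply: content_exists; rewrite dr rho1.
apply: (@ltn_trans y).
  by apply: (@standard_lt (T m) d); rewrite // /below rowm dr dc !eqxx orbT.
by apply: row_increasing; rewrite Ty ?dr ?dc.
Qed.

End Standard.

Lemma row_word_inj : {in SSVT la rho &, injective row_word}.
Proof.
move=> T T' stT stT' eqw; apply/ffunP => m.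
have eqr : cell_row (T m) = cell_row (T' m) by rewrite -!nth_row_word eqw.
by apply: cell_inj => //; rewrite !cell_col_rank // eqw eqr.
Qed.

(** The preimage is forced by [cell_col_rank]: the column of [m] is its rank among equal letters
    divided by the density of its row. The prefix inequalities then yield the vertical order. *)
Lemma row_word_surj (w : seq nat) :
  size w = M -> all (ltn^~ (size la)) w ->
  (forall i, i < size la -> count_mem i w = nth 0 la i * nth 0 rho i) ->
  (forall i, i.+1 < size la -> nth 0 rho i.+1 = 1) ->
  (forall i q, i.+1 < size la -> q <= M ->
     nth 0 rho i * count_mem i.+1 (take q w) <= count_mem i (take q w)) ->
  exists2 T, T \in SSVT la rho & row_word T = w.
Proof.
move=> szw /all_nthP ltw cntw rho1 ballot_w.
have lt_row (m : 'I_M) : nth 0 w m < size la by apply: ltw; rewrite szw.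
pose rk (m : nat) := count_mem (nth 0 w m) (take m w).
have rk_lt (m : 'I_M) : rk m < nth 0 la (nth 0 w m) * nth 0 rho (nth 0 w m).
  rewrite -cntw //; apply: leq_trans (_ : count_mem (nth 0 w m) (take m.+1 w) <= _).
    by rewrite count_takeS ?szw // eqxx addn1.
  have := leq_count_take (nth 0 w m) w (ltn_ord m).
  by rewrite [take M w]take_oversize ?szw.
have rho0 (m : 'I_M) : 0 < nth 0 rho (nth 0 w m).
  by have := rk_lt m; case: (nth 0 rho _) => //; rewrite muln0.
have /fin_all_exists [f fP] : forall m : 'I_M, exists c : cell la,
    cell_row c = nth 0 w m /\ cell_col c = rk m %/ nth 0 rho (nth 0 w m).
  by move=> m; apply: cell_exists; [|rewrite ltn_divLR].
pose T : filling la rho := finfun f.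
have rT m : cell_row (T m) = nth 0 w m by rewrite ffunE; case: (fP m).
have cT m : cell_col (T m) = rk m %/ nth 0 rho (nth 0 w m).
  by rewrite ffunE; case: (fP m).
have rwT : row_word T = w.
  apply: (@eq_from_nth _ 0) => [|m]; rewrite size_row_word // => ltm.
  by rewrite (nth_row_word T (Ordinal ltm)) rT.
exists T => //; rewrite inE; apply/andP; split.
  apply/forallP => c; set i := cell_row c; set j := cell_col c.
  have lti : i < size la := ltn_cell_row c.
  have ltj : j < nth 0 la i := ltn_cell_col c.
  have lerho : j * nth 0 rho i <= j.+1 * nth 0 rho i by rewrite leq_mul2r leqnSn orbT.
  (* The integers of this cell are the letters [i] of rank at least [j * rho_i] and less than
     [j.+1 * rho_i]. As [i] occurs [la_i * rho_i] times in all, the minima reduce to these two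
     bounds. *)
  have := count_rank i lerho (leqnn (size w)); rewrite take_size cntw // szw.
  rewrite (minn_idPl _) ?leq_mul2r ?ltj ?orbT //.
  rewrite (minn_idPl _) ?leq_mul2r ?(ltnW ltj) ?orbT //.
  rewrite mulSn addnK => <-; rewrite -card_ord_count; apply/eqP/eq_card => m.
  rewrite !inE; apply/eqP/andP => [Tm|[/eqP wi rkj]].
    have wi : nth 0 w m = i by rewrite -rT Tm.
    rewrite wi eqxx; split=> //; have := cT m; rewrite Tm /rk wi -/j => ->.
    by rewrite leq_trunc_div ltn_ceil // -wi.
  apply: cell_inj; rewrite ?rT // cT /rk wi; apply/eqP.
  have rhoi : 0 < nth 0 rho i by rewrite -wi.
  rewrite -/j eqn_leq leq_divRL // -(ltnS _ j) ltn_divLR //.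
  by case/andP: rkj => -> ->.
apply/forallP => c; apply/forallP => d; apply/implyP => adj.
apply/forall_inP => m; rewrite inE => /eqP Tm.
apply/forall_inP => p; rewrite inE => /eqP Tp.
have [rm cm] : nth 0 w m = cell_row c /\ rk m %/ nth 0 rho (cell_row c) = cell_col c.
  by rewrite -Tm cT rT.
have [rp cp] : nth 0 w p = cell_row d /\ rk p %/ nth 0 rho (cell_row d) = cell_col d.
  by rewrite -Tp cT rT.
rewrite ltnNge; apply/negP => lepm.
case/orP: adj => /andP [/eqP er /eqP ec].
  (* Ranks of equal letters grow with position, so [p <= m] would put [p] weakly left of [m]. *)
  suff : cell_col d <= cell_col c by rewrite ec ltnn.
  rewrite -cp -cm er; apply: leq_div2r; rewrite /rk rm rp er.
  exact: leq_count_take.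
have lti : (cell_row c).+1 < size la by rewrite -er ltn_cell_row.
have neq : p != m :> nat.
  by apply/eqP => eqpm; move: rm; rewrite -eqpm rp er => /eqP; rewrite gtn_eqF.
have ltpm : p < m by rewrite ltn_neqAle neq.
(* The prefix ending at [p] has [(cell_col c).+1] letters of the lower row, hence at least that many
   times the upper density of upper-row letters, all before [m]; but the rank of [m] is below this
   number. *)
have := ballot_w _ p.+1 lti (ltn_ord p).
rewrite [in X in X <= _]count_takeS ?szw // rp er eqxx.
move: cp; rewrite /rk rp er rho1 // divn1 ec => ->.
have := leq_count_take (cell_row c) w ltpm.
have : rk m < (cell_col c).+1 * nth 0 rho (cell_row c).
  by rewrite -cm ltn_ceil // -rm.
by rewrite /rk rm addn1 mulnC; lia.
Qed.

End Fillings.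

(** * Three equal rows with density [(K, 1, 1)] *)

Lemma ssvt_size_nseq3 n K : ssvt_size (nseq 3 n) [:: K; 1; 1] = n * K + n + n.
Proof. by rewrite /ssvt_size !big_ord_recl big_ord0 /= !muln1 addn0 addnA. Qed.

Lemma card_SSVT_nseq3 n K :
  #|SSVT (nseq 3 n) [:: K; 1; 1]| = excess_ballot K n n 0.
Proof.
set la := nseq 3 n; set rho := [:: K; 1; 1].
have szM := ssvt_size_nseq3 n K.
(* The row words of the tableaux and the filtered list of words are both duplicate-free, so equal
   membership gives equal size. *)
rewrite cardE -(size_map (@row_word la rho)) /excess_ballot /num_ballot.
rewrite addn0 [K * n]mulnC -size_filter; apply/perm_size/uniq_perm.
- rewrite map_inj_in_uniq ?enum_uniq // => T T'.
  by rewrite !mem_enum; apply: row_word_inj.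
- exact/filter_uniq/words_uniq.
move=> w; rewrite mem_filter mem_words -szM; apply/mapP/idP.
  case=> T; rewrite mem_enum => stT ->.
  have cnt := count_row_word stT; have bal := row_word_ballot stT.
  rewrite size_row_word eqxx /ballot_word (cnt 0) // (cnt 1) // (cnt 2) //.
  rewrite /= !muln1 !eqxx /=; apply/andP; split.
    apply/allP => q; rewrite mem_iota size_row_word ltnS /= => leq.
    have := bal 0 q isT (leqnn _) (erefl _) leq.
    have := bal 1 q isT (leqnn _) (erefl _) leq.
    by rewrite /= mul1n /admissible => -> ->.
  by apply/allP => _ /mapP [m _ ->]; apply: ltn_cell_row.
case/and3P => /and4P [/eqP c0 /eqP c1 /eqP c2 bal] /eqP szw ltw.
have [|||T stT eqw] := @row_word_surj la rho w szw ltw.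
- by case=> [|[|[|i]]] //= _; rewrite ?muln1.
- by case=> [|[|i]].
- move=> i q lti leq; have /allP /(_ q) := bal.
  rewrite mem_iota ltnS szw leq => /(_ isT) /andP [bal01 bal12].
  by case: i lti => [|[|i]] //= _; rewrite mul1n.
by exists T; rewrite ?mem_enum.
Qed.

(** * Polynomial formulas for the counts *)

Import Order.TTheory GRing.Theory Num.Theory.
Local Open Scope ring_scope.

(* The values of [excess_ballot K b c t] at x = K for b <= 3, found by summing
   the recursion over t; entries with b > 3 are junk. *)
Definition excess_poly (b c : nat) (x t : rat) : rat :=
  match b, c with
  | 0, 0 => 1
  | 1, 0 => t + 1
  | 1, 1 => (t + 1) * (t + 2) / 2
  | 2, 0 => (t + 1) * (t + 2 * x + 2) / 2
  | 2, 1 =>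
    (t + 1) * (2 * t ^+ 2 + (6 * x + 10) * t + 3 * x ^+ 2 + 15 * x + 12) / 6
  | 2, 2 =>
    (t + 1) * (t + 2)
    * (t ^+ 2 + (4 * x + 7) * t + 3 * x ^+ 2 + 15 * x + 12) / 12
  | 3, 0 =>
    (t + 1) * (t ^+ 2 + (6 * x + 5) * t + 9 * x ^+ 2 + 15 * x + 6) / 6
  | 3, 1 =>
    (t + 1)
    * (3 * t ^+ 3 + (24 * x + 27) * t ^+ 2
       + (60 * x ^+ 2 + 144 * x + 78) * t
       + 44 * x ^+ 3 + 180 * x ^+ 2 + 208 * x + 72) / 24
  | 3, 2 =>
    (t + 1)
    * (t ^+ 4 + (10 * x + 14) * t ^+ 3
       + (34 * x ^+ 2 + 104 * x + 71) * t ^+ 2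
       + (44 * x ^+ 3 + 230 * x ^+ 2 + 346 * x + 154) * t
       + 16 * x ^+ 4 + 136 * x ^+ 3 + 368 * x ^+ 2 + 368 * x + 120) / 24
  | 3, 3 =>
    (t + 1) * (t + 2)
    * (t ^+ 4 + (12 * x + 18) * t ^+ 3
       + (51 * x ^+ 2 + 165 * x + 119) * t ^+ 2
       + (88 * x ^+ 3 + 477 * x ^+ 2 + 743 * x + 342) * t
       + 48 * x ^+ 4 + 408 * x ^+ 3 + 1104 * x ^+ 2 + 1104 * x + 360) / 144
  | _, _ => 0
  end.

(** The recursion lowers [t], or lowers [c], or lowers [b] while raising [t]; hence nested
    inductions on [b], [c] and [t], with the inner variables left arbitrary. The bound on [b] leaves
    finitely many polynomial identities in [K] and [t]. *)
Lemma excess_polyE (K b c t : nat) : (b <= 3)%N ->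
  (excess_ballot K b c t)%:R = excess_poly b c K%:R t%:R.
Proof.
elim: b c t => [|b IHb] c t leb3.
  by case: c => [|c]; [rewrite excess_ballot00 | rewrite excess_ballot_gt].
elim: c t => [|c IHc] t.
  elim: t => [|t IHt].
    rewrite excess_ballot0 // mul0n addn0 IHb 1?ltnW //.
    by case: b leb3 {IHb} => [|[|[|[]]]] //= _; field.
  rewrite excess_ballotS // mul0n addn0 natrD IHt IHb 1?ltnW // -addn1 !natrD.
  by case: b leb3 {IHb IHt} => [|[|[|[]]]] //= _; field.
(* For more twos than ones, both the count and the default entry of the table are 0. *)
have [lecb|ltbc] := leqP c b; last first.
  rewrite excess_ballot_gt //.
  by case: b leb3 ltbc {IHb IHc} => [|[|[|[]]]] // _; case: c => [|[|[|[|[]]]]].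
elim: t => [|t IHt].
  rewrite excess_ballot0 // mul1n natrD IHb 1?ltnW //= IHc.
  by case: b leb3 lecb {IHb IHc} => [|[|[|[]]]] // _;
    case: c => [|[|[|[]]]] //= _; field.
rewrite excess_ballotS // mul1n !natrD IHt IHb 1?ltnW //= IHc -addn1 !natrD.
by case: b leb3 lecb {IHb IHc IHt} => [|[|[|[]]]] // _;
  case: c => [|[|[|[]]]] //= _; field.
Qed.

(** The variable is [x = K + 1] because the top-row density is [K = k - 1]. *)
Lemma excess_ballot22 (K : nat) (x := (K.+1)%:R : rat) :
  (excess_ballot K 2 2 0)%:R = 1 / 2 * x ^+ 2 + 3 / 2 * x.
Proof.
rewrite [LHS](@excess_polyE _ 2 _ _ isT) /excess_poly /x.
by rewrite -addn1 natrD; field.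
Qed.

Lemma excess_ballot33 (K : nat) (x := (K.+1)%:R : rat) :
  (excess_ballot K 3 3 0)%:R =
    2 / 3 * x ^+ 4 + 3 * x ^+ 3 + 7 / 3 * x ^+ 2 - x.
Proof.
rewrite [LHS](@excess_polyE _ 3 _ _ isT) /excess_poly /x.
by rewrite -addn1 natrD; field.
Qed.

(** The table stops at [b = 3]. Unfolding the recursion at zero surplus for [c] from 4 down to 0
    expresses the count through entries with [b = 3] and [t = K], of which [c = 4] vanishes. *)
Lemma excess_ballot44 (K : nat) (x := (K.+1)%:R : rat) :
  (excess_ballot K 4 4 0)%:R =
    25 / 18 * x ^+ 6 + 61 / 8 * x ^+ 5 + 175 / 18 * x ^+ 4
    - 35 / 24 * x ^+ 3 - 37 / 9 * x ^+ 2 + 5 / 6 * x.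
Proof.
have -> : excess_ballot K 4 4 0 = excess_ballot K 3 3 K +
    (excess_ballot K 3 2 K + (excess_ballot K 3 1 K + excess_ballot K 3 0 K)) :> nat.
  rewrite (@excess_ballot0 K 3 4 isT) (@excess_ballot0 K 3 3 isT).
  rewrite (@excess_ballot0 K 3 2 isT) (@excess_ballot0 K 3 1 isT).
  rewrite (@excess_ballot0 K 3 0 isT) (@excess_ballot_gt K 3 4 K isT) mul0n.
  by rewrite !mul1n add0n addn0.
(* Hiding the right-hand side keeps [natrD] from matching its numerals. *)
set rhs := RHS.
rewrite !natrD !(@excess_polyE K 3 _ _ isT) /excess_poly /rhs /x.
by rewrite -addn1 natrD; field.
Qed.

Theorem proposition5p2 (k : nat) (hk : (1 <= k)%N) :
  let rho := [:: (k - 1)%N; 1%N; 1%N] in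
  let x : rat := k%:R in
  [/\ (#|SSVT (nseq 3 2%N) rho|)%:R = 1 / 2 * x ^+ 2 + 3 / 2 * x,
      (#|SSVT (nseq 3 3%N) rho|)%:R =
        2 / 3 * x ^+ 4 + 3 * x ^+ 3 + 7 / 3 * x ^+ 2 - x
    & (#|SSVT (nseq 3 4%N) rho|)%:R =
        25 / 18 * x ^+ 6 + 61 / 8 * x ^+ 5 + 175 / 18 * x ^+ 4
        - 35 / 24 * x ^+ 3 - 37 / 9 * x ^+ 2 + 5 / 6 * x].
Proof.
case: k hk => // K _; rewrite subn1 succnK => rho x; split.
- exact: etrans (congr1 _ (card_SSVT_nseq3 2 K)) (excess_ballot22 K).
- exact: etrans (congr1 _ (card_SSVT_nseq3 3 K)) (excess_ballot33 K).
- exact: etrans (congr1 _ (card_SSVT_nseq3 4 K)) (excess_ballot44 K).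
Qed.
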